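(* There exists a planar graph that does not admit a mixed $1$-stack $1$-queue layout.
   Context: Let $G=(V,E)$ be a graph. A vertex ordering is a total order $<$ on $V$. For an edge $e$, let $L(e)<R(e)$ denote its endpoints. Two edges $e,f$ cross if $L(e)<L(f)<R(e)<R(f)$, and nest if $L(e)<L(f)<R(f)<R(e)$. A stack is a set of edges no two of which cross; a queue is a set of edges no two of which nest. A mixed $1$-stack $1$-queue layout of $G$ is a vertex ordering $<$ of $G$ together with a partition of $E$ into a stack $S$ and a queue $Q$ (both with respect to the same ordering $<$). *)

(* Defs.v *)
From HB Require Import structures.
From mathcomp Require Import all_boot all_order all_algebra.
From mathcomp Require Import all_classical all_reals all_analysis.
From mathcomp Require Import Rstruct Rstruct_topology.
From Stdlib Require Import Reals.
Set Implicit Arguments. Unset Strict Implicit. Unset Printing Implicit Defensive.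
Import Order.TTheory GRing.Theory Num.Theory.

Definition simple_graph (n : nat) (e : rel 'I_n) : Prop :=
  (forall u v, e u v = e v u) /\ (forall u, ~~ e u u).

(* Each edge {u,v} is represented once, by the pair with (u < v)%N. *)
Definition is_edge (n : nat) (e : rel 'I_n) (u v : 'I_n) : Prop :=
  e u v /\ (u < v)%N.

Local Open Scope ring_scope.
Local Open Scope classical_set_scope.

Definition planar_drawing (n : nat) (e : rel 'I_n)
    (pt : 'I_n -> (Rdefinitions.R * Rdefinitions.R)%type)
    (gam : 'I_n -> 'I_n -> Rdefinitions.R -> (Rdefinitions.R * Rdefinitions.R)%type) : Prop :=
  injective pt /\
  (forall u v, is_edge e u v ->
     gam u v 0 = pt u /\ gam u v 1 = pt v /\
     {within `[(0 : Rdefinitions.R), 1], continuous (gam u v)} /\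
     (forall s t : Rdefinitions.R, 0 <= s <= 1 -> 0 <= t <= 1 ->
        gam u v s = gam u v t -> s = t) /\
     (forall (t : Rdefinitions.R) w, 0 < t < 1 -> gam u v t <> pt w)) /\
  (forall u v u' v', is_edge e u v -> is_edge e u' v' ->
     forall s t : Rdefinitions.R, 0 < s < 1 -> 0 < t < 1 ->
       gam u v s = gam u' v' t -> u = u' /\ v = v').

Definition planar (n : nat) (e : rel 'I_n) : Prop :=
  exists pt gam, @planar_drawing n e pt gam.

Local Close Scope classical_set_scope.
Local Close Scope ring_scope.

(* A vertex ordering is given by an injective rank function pos : 'I_n -> nat
   (x < y in the ordering iff pos x < pos y).  The edge {u,v} has
   L = the endpoint of smaller rank, R = the one of larger rank. *)
Definition oriented_edge (n : nat) (e : rel 'I_n) (pos : 'I_n -> nat) (a b : 'I_n) : Prop :=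
  e a b /\ (pos a < pos b)%N.

(* The partition E = S ⊔ Q is given by inS : each edge {a,b} (with pos a < pos b)
   is in S iff inS a b, and in Q otherwise. *)
Definition mixed_1s1q_layout (n : nat) (e : rel 'I_n)
    (pos : 'I_n -> nat) (inS : 'I_n -> 'I_n -> bool) : Prop :=
  injective pos /\
  (forall a b c d, oriented_edge e pos a b -> oriented_edge e pos c d ->
     inS a b -> inS c d ->
     ~ ((pos a < pos c)%N /\ (pos c < pos b)%N /\ (pos b < pos d)%N)) /\
  (forall a b c d, oriented_edge e pos a b -> oriented_edge e pos c d ->
     ~~ inS a b -> ~~ inS c d ->
     ~ ((pos a < pos c)%N /\ (pos c < pos d)%N /\ (pos d < pos b)%N)).

Definition has_mixed_1s1q_layout (n : nat) (e : rel 'I_n) : Prop :=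
  exists pos inS, @mixed_1s1q_layout n e pos inS.

(* Main.v *)
(** Glue N copies of a gadget along two common vertices A and B: the gadget is
    an edge xy, both of whose ends are joined to A and B, together with three
    further vertices joined to x and y.  Call two copies twins if their vertices
    are ordered in the same way (relative to one another and to A, B) and
    corresponding edges lie on the same page; by pigeonhole a large N forces
    twins.  Two twin copies cannot coexist in a mixed layout: this is a search
    over the relative orders of 12 vertices and the pages of 11 edges, pruned
    by twinship, hence small. *)
Require Import Defs.
From mathcomp Require Import all_boot all_order all_algebra.
From mathcomp Require Import all_classical all_reals all_analysis.
From mathcomp Require Import Rstruct Rstruct_topology.
From mathcomp Require Import zify lra.
Set Implicit Arguments. Unset Strict Implicit. Unset Printing Implicit Defensive.
Import Order.TTheory GRing.Theory Num.Theory numFieldNormedType.Exports.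

(** * The graph *)

(* Kinds are A = 0, B = 1, x = 2, y = 3 and 4, 5, 6 for the common neighbours of
   x and y; [vtx c k] is the vertex of kind [k] in copy [c], where A and B
   belong to all copies. *)
Definition vtx (c k : nat) : nat := if k < 2 then k else 5 * c + k.

Definition gadget_edges : seq (nat * nat) :=
  [:: (0, 2); (1, 2); (0, 3); (1, 3); (2, 3);
      (2, 4); (3, 4); (2, 5); (3, 5); (2, 6); (3, 6)].

Lemma gadget_edges_ind (P : nat -> nat -> Prop) :
  P 0 2 -> P 1 2 -> P 0 3 -> P 1 3 -> P 2 3 ->
  P 2 4 -> P 3 4 -> P 2 5 -> P 3 5 -> P 2 6 -> P 3 6 ->
  forall k l, (k, l) \in gadget_edges -> P k l.
Proof.
move=> P1 P2 P3 P4 P5 P6 P7 P8 P9 P10 P11 k l; rewrite !inE.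
by do 10?[case/predU1P => [[-> ->] //|]]; move=> /eqP[-> ->].
Qed.

(** [kind] and [copy] decode [vtx]. Truncated subtraction puts A and B in copy 0, so comparisons of
    copies are guarded by tests such as [u < 2]. *)
Definition kind (v : nat) : nat := if v < 2 then v else (v - 2) %% 5 + 2.
Definition copy (v : nat) : nat := (v - 2) %/ 5.

Lemma kind_lt7 v : kind v < 7.
Proof. by rewrite /kind; case: ifP; lia. Qed.

Lemma kind_ge2 v : (2 <= kind v) = (2 <= v).
Proof. by rewrite /kind; case: ifP; lia. Qed.

Definition glued (N : nat) : rel 'I_(5 * N).+2 := fun u v =>
  (((kind u, kind v) \in gadget_edges) || ((kind v, kind u) \in gadget_edges))
  && [|| u < 2, v < 2 | copy u == copy v].

Lemma kind_copy (u v : nat) : kind u = kind v -> (u < 2) || (copy u == copy v) -> u = v.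
Proof. by rewrite /kind /copy; case: ifP; case: ifP; lia. Qed.

Lemma glued_edgeP N (u v : 'I_(5 * N).+2) : is_edge (@glued N) u v ->
  [/\ (kind u, kind v) \in gadget_edges, 2 <= v & (u < 2) || (copy u == copy v)].
Proof.
move=> [/andP[uv same] lt_uv].
have v2 : 2 <= v.
  rewrite leqNgt; apply/negP => v2; have u2 := ltn_trans lt_uv v2.
  move: uv; rewrite /kind u2 v2.
  by move: lt_uv v2; case: (nat_of_ord v) => [|[|//]] //; case: (nat_of_ord u) => [|[]].
move: same; rewrite [v < 2]ltnNge v2 /= => same; split=> //.
(* [gadget_edges] lists the smaller kind first, and numbers grow with kinds within a copy, so the
   reversed pair contradicts [u < v]. *)
case/orP: uv => // vu.
suff : kind v < kind u.
  by move: same lt_uv v2; rewrite /kind /copy; case: ifP; case: ifP; lia.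
by elim/gadget_edges_ind: (kind v) (kind u) / vu.
Qed.

Lemma glued_simple N : simple_graph (@glued N).
Proof.
split=> [u v|u]; first by rewrite /glued orbC eq_sym orbCA.
rewrite /glued orbb negb_and; apply/orP; left.
by apply/negP; rewrite /gadget_edges !inE; move: (kind u) => k; rewrite !xpair_eqE; lia.
Qed.

Lemma glued_vtx N (u v : 'I_(5 * N).+2) c k l :
  (k, l) \in gadget_edges -> u = vtx c k :> nat -> v = vtx c l :> nat -> glued u v.
Proof.
have kindE m : m < 7 -> kind (vtx c m) = m.
  by rewrite /kind /vtx => m7; case: (ltnP m 2) => [->//|m2]; case: ifP; lia.
move=> kl uE vE.
have [k7 l7 l2] : [/\ k < 7, l < 7 & 2 <= l] by elim/gadget_edges_ind: k l / kl {uE vE}.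
rewrite /glued uE vE !kindE // kl /=.
by rewrite /vtx /copy; case: (ltnP k 2) => [->//|k2]; rewrite (ltnNge l) l2 /=; apply/orP; right; lia.
Qed.

(** * Twin copies cannot coexist *)

(* A vertex order is represented by the list of the vertices placed so far; on
   vertices not yet placed [before] is false, so a [clash] is always genuine. *)
Fixpoint before (s : seq nat) (a b : nat) : bool :=
  if s is x :: t then if x == a then b \in t else before t a b else false.

Fixpoint insertions (v : nat) (s : seq nat) : seq (seq nat) :=
  (v :: s) :: (if s is x :: t then map (cons x) (insertions v t) else [::]).

Definition clash (s : seq nat) (c : bool) (e f : nat * nat) : bool :=
  let: (a, b) := e in let: (a', b') := f in
  if c then [&& before s a a', before s a' b & before s b b']
  else [&& before s a a', before s a' b' & before s b' b].

Definition mismatch (s : seq nat) (k : nat) : bool :=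
  has (fun l => before s (vtx 0 k) (vtx 0 l) && before s (vtx 1 l) (vtx 1 k)
   || before s (vtx 0 l) (vtx 0 k) && before s (vtx 1 k) (vtx 1 l)) (iota 0 7).

Definition orient (s : seq nat) (e : nat * nat) : nat * nat :=
  if before s e.1 e.2 then e else (e.2, e.1).

Definition compatible (s : seq nat) (c : bool) (es : seq (nat * nat)) (f : nat * nat) :=
  all (fun e => ~~ (clash s c e f || clash s c f e)) es.

Inductive step := Place of nat | Colour of nat & nat.

(* [cs c] lists the edges already put on the stack ([c = true]) or on the queue
   ([c = false]).  [Place] tries all positions of a vertex, [Colour] both pages
   for an edge of the gadget, in both copies at once.  By symmetry between the
   copies, x (number 2) in copy 0 may be assumed to precede x (number 7) in
   copy 1.  The conditionals are not written with [||] because [vm_compute]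
   would evaluate both sides. *)
Fixpoint refute (st : seq step) (s : seq nat) (cs : bool -> seq (nat * nat)) : bool :=
  match st with
  | [::] => false
  | Place v :: st' =>
    (v < 12) && (v \notin s) && all (fun s' =>
        if before s' 7 2 then true
        else if mismatch s' (v - 5) then true else refute st' s' cs)
      (insertions v s)
  | Colour k l :: st' =>
    let e0 := orient s (vtx 0 k, vtx 0 l) in
    let e1 := orient s (vtx 1 k, vtx 1 l) in
    let attempt c :=
      if compatible s c (cs c) e0 && compatible s c (e0 :: cs c) e1 then
        refute st' s (fun d => if d == c then [:: e0, e1 & cs c] else cs d)
      else true in
    [&& (k, l) \in gadget_edges, attempt true & attempt false]
  end.

(** Twins are placed in succession and edges coloured once their ends are placed, so that clashes
    prune early. *)
Definition twin_search : seq step :=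
  [:: Place 0; Place 1; Place 2; Place 7; Colour 0 2; Colour 1 2;
      Place 3; Place 8; Colour 2 3; Colour 0 3; Colour 1 3;
      Place 4; Place 9; Colour 2 4; Colour 3 4;
      Place 5; Place 10; Colour 2 5; Colour 3 5;
      Place 6; Place 11; Colour 2 6; Colour 3 6].

Lemma refute_twin_search : refute twin_search [::] (fun _ => [::]).
Proof. by vm_compute. Qed.

(** * Soundness of the search *)

Lemma before_lt (pos : nat -> nat) s a b :
  sorted (relpre pos ltn) s -> before s a b -> pos a < pos b.
Proof.
have tr : transitive (relpre pos ltn) by move=> x y z /=; apply: ltn_trans.
elim: s => //= x s IHs xs; case: eqP => [<-|_] sb.
  by move/(order_path_min tr)/allP/(_ _ sb): xs.
exact: IHs (path_sorted xs) sb.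
Qed.

(** Inserting [v] before the first entry of larger [pos] works, so [Place] always tries the position
    used by a given layout. *)
Lemma sorted_insertion (pos : nat -> nat) v s :
  sorted (relpre pos ltn) s -> {in s, forall u, pos u <> pos v} ->
  exists2 s', s' \in insertions v s &
    sorted (relpre pos ltn) s' /\ perm_eq s' (v :: s).
Proof.
elim: s => [|x s IHs] xs_sorted sv.
  by exists [:: v]; rewrite ?mem_seq1.
case: (ltnP (pos v) (pos x)) => vx.
  by exists [:: v, x & s]; rewrite /= ?mem_head ?vx.
have [] := IHs (path_sorted xs_sorted).
  by move=> u us; apply: sv; rewrite inE us orbT.
move=> s' s'_in [s'_sorted s'_perm]; exists (x :: s').
  by rewrite /= inE map_f ?orbT.
split.
  rewrite /= path_sortedE; last by move=> ? ? ? /=; apply: ltn_trans.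
  rewrite s'_sorted andbT (perm_all _ s'_perm) /= ltn_neqAle vx andbT.
  apply/andP; split; first by apply/eqP/sv; rewrite mem_head.
  move: xs_sorted => /= /order_path_min; apply.
  by move=> ? ? ? /=; apply: ltn_trans.
by rewrite (perm_trans (y := [:: x, v & s])) ?perm_cons //; apply/permP => p /=; rewrite addnCA.
Qed.

Section TwinLayout.
Variables (pos : nat -> nat) (ed : bool -> rel nat).
Hypothesis pos_inj : {in gtn 12 &, injective pos}.
Hypothesis ed_sym : forall c, symmetric (ed c).
Hypothesis stack : forall a b a' b', ed true a b -> ed true a' b' ->
  ~ [/\ pos a < pos a', pos a' < pos b & pos b < pos b'].
Hypothesis queue : forall a b a' b', ed false a b -> ed false a' b' ->
  ~ [/\ pos a < pos a', pos a' < pos b' & pos b' < pos b].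
Hypothesis twin_ed : forall k l, (k, l) \in gadget_edges ->
  exists c, ed c (vtx 0 k) (vtx 0 l) && ed c (vtx 1 k) (vtx 1 l).
Hypothesis twin_pos : forall k l, k < 7 -> l < 7 ->
  (pos (vtx 0 k) < pos (vtx 0 l)) = (pos (vtx 1 k) < pos (vtx 1 l)).
Hypothesis x_lt : pos (vtx 0 2) < pos (vtx 1 2).

Lemma clashF s c e f : sorted (relpre pos ltn) s ->
  ed c e.1 e.2 -> ed c f.1 f.2 -> clash s c e f = false.
Proof.
move=> /before_lt lt_s; case: e f => [a b] [a' b'] /= ab ab'; apply/negP.
case: c ab ab' => ab ab' /and3P[/lt_s ? /lt_s ? /lt_s ?].
  exact: (stack ab ab').
exact: (queue ab ab').
Qed.

Lemma mismatchF s k : sorted (relpre pos ltn) s -> k < 7 ->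
  mismatch s k = false.
Proof.
move=> /before_lt lt_s k7; apply/negP => /hasP[l]; rewrite mem_iota => /= l7.
case/orP=> /andP[/lt_s lt0 /lt_s lt1].
  by move: lt0; rewrite twin_pos // ltnNge ltnW.
by move: lt1; rewrite -twin_pos // ltnNge ltnW.
Qed.

Lemma orient_ed s c e : ed c e.1 e.2 -> ed c (orient s e).1 (orient s e).2.
Proof. by rewrite /orient; case: before; rewrite //= ed_sym. Qed.

(** At each step some branch agrees with the layout, and pruning spares it. Unless a side check
    fails first, it lasts to the end of the script; either way the answer is [false]. *)
Lemma refuteF st s cs : sorted (relpre pos ltn) s -> all (gtn 12) s ->
  (forall c, all (fun e => ed c e.1 e.2) (cs c)) -> refute st s cs = false.
Proof.
have compatP s' c es f : sorted (relpre pos ltn) s' ->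
    all (fun e => ed c e.1 e.2) es -> ed c f.1 f.2 -> compatible s' c es f.
  move=> s'_sorted /allP es_ed f_ed; apply/allP => e /es_ed e_ed.
  by rewrite !clashF.
elim: st s cs => //= -[v|k l] st IHst s cs s_sorted s12 cs_ed; apply/negP.
  case/andP=> /andP[v12 vs] /allP ref.
  have [u us /pos_inj uv|s' s'_in [s'_sorted s'_perm]] :=
      sorted_insertion s_sorted (v := v).
    by move: vs; rewrite -uv ?us //; apply: (allP s12).
  move: (ref _ s'_in); case: ifP => [/(before_lt s'_sorted)|_].
    by rewrite ltnNge ltnW.
  (* For [v] in copy 1, [v - 5] is its kind; otherwise truncation gives 0 or 1, again a valid
     kind. *)
  rewrite mismatchF //; last by rewrite (leq_ltn_trans (leq_sub2r _ (v12 : v <= 11))).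
  by rewrite IHst // (perm_all _ s'_perm) /= s12 andbT.
case/and3P=> kl; set e0 := orient _ _; set e1 := orient _ _ => rt rf.
have [c /andP[ed0 ed1]] := twin_ed kl.
have {}ed0 : ed c e0.1 e0.2 by apply: orient_ed.
have {}ed1 : ed c e1.1 e1.2 by apply: orient_ed.
have e0s_ed : all (fun e => ed c e.1 e.2) (e0 :: cs c) by rewrite /= ed0 cs_ed.
have cs'_ed d : all (fun e => ed d e.1 e.2)
    (if d == c then [:: e0, e1 & cs c] else cs d).
  by case: eqP => [->|_]; rewrite //= ed0 ed1 cs_ed.
have {kl rt rf} : if compatible s c (cs c) e0 && compatible s c (e0 :: cs c) e1 then
    refute st s (fun d => if d == c then [:: e0, e1 & cs c] else cs d) else true.
  by case: c {ed0 ed1 e0s_ed cs'_ed}.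
by rewrite !compatP // IHst.
Qed.

Lemma no_twin_layout : False.
Proof. by have := refute_twin_search; rewrite refuteF. Qed.

End TwinLayout.

(** * Twins by pigeonhole *)

Lemma glued_no_layout : exists N, ~ has_mixed_1s1q_layout (@glued N).
Proof.
pose type := {ffun 'I_7 * 'I_7 -> bool * bool}.
pose N := #|{: type}|.+1; exists N => -[pos [inS [pos_inj [stack queue]]]].
(* [inS] is meaningful with the lower end first; [colour] is its symmetric form. *)
pose colour u v := if pos u < pos v then inS u v else inS v u.
have colourC u v : colour u v = colour v u.
  by rewrite /colour; case: ltngtP => // /pos_inj ->.
pose V i k : 'I_(5 * N).+2 := inord (vtx i k).
have VE i k : i < N -> k < 7 -> V i k = vtx i k :> nat.
  by move=> iN k7; rewrite inordK // /vtx; case: ifP; lia.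
pose typ (i : 'I_N) : type :=
  [ffun kl : 'I_7 * 'I_7 => (pos (V i kl.1) < pos (V i kl.2), colour (V i kl.1) (V i kl.2))].
have [i [j [ij typ_ij]]] : exists i j, i <> j /\ typ i = typ j.
  have /injectivePn[i [j ij typ_ij]] : ~~ injectiveb typ.
    by apply/injectiveP => /leq_card; rewrite [#|{: 'I_N}|]card_ord ltnn.
  by exists i, j; split=> //; apply/eqP.
wlog lt_ij : i j ij typ_ij / pos (V i 2) < pos (V j 2).
  move=> W; case: (ltngtP (pos (V i 2)) (pos (V j 2))) => [|ji|/pos_inj/(congr1 (@nat_of_ord _))].
  - exact: W.
  - by apply: (W j i) => // /esym.
  - by rewrite !VE // /vtx /= => ?; apply: ij; apply: val_inj => /=; lia.
have typE k l : k < 7 -> l < 7 -> (pos (V i k) < pos (V i l)) = (pos (V j k) < pos (V j l)) /\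
    colour (V i k) (V i l) = colour (V j k) (V j l).
  move=> k7 l7; move/ffunP/(_ (Ordinal k7, Ordinal l7)): typ_ij; rewrite !ffunE /=.
  by case.
(* Copies 0 and 1 of the search are carried to copies [i] and [j]; subtracting 5 undoes the shift of
   copy 1. *)
pose f m := if m < 7 then V i m else V j (m - 5).
have f0 k : k < 7 -> f (vtx 0 k) = V i k.
  by rewrite /f /vtx; case: (k < 2) => /= ->.
have f1 k : k < 7 -> f (vtx 1 k) = V j k.
  rewrite /f /vtx => k7; case: (ltnP k 2) => [k2|k2]; first by rewrite k7 /V /vtx k2.
  by rewrite ltnNge (_ : 7 <= 5 * 1 + k) /=; last lia; congr V; lia.
pose ed c a b := glued (f a) (f b) && (colour (f a) (f b) == c).
apply: (@no_twin_layout (pos \o f) ed).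
- move=> a b a12 b12 /pos_inj/(congr1 (@nat_of_ord _)) /=; rewrite !inE in a12 b12.
  have ij' : i <> j :> nat by move/val_inj.
  have [] := (ltn_ord i, ltn_ord j); rewrite /f.
  by case: ifP; case: ifP => ? ? ? ?; rewrite !VE //; try lia;
    rewrite /vtx; case: ifP; case: ifP; lia.
- by move=> c a b; rewrite /ed colourC (glued_simple N).1.
- move=> a b a' b' /andP[ab /eqP cab] /andP[ab' /eqP cab'] /= [? ? ?].
  have lab : pos (f a) < pos (f b) by lia.
  have lab' : pos (f a') < pos (f b') by lia.
  rewrite /colour lab in cab; rewrite /colour lab' in cab'.
  by apply: (stack (f a) (f b) (f a') (f b')).
- move=> a b a' b' /andP[ab /eqP cab] /andP[ab' /eqP cab'] /= [? ? ?].
  have lab : pos (f a) < pos (f b) by lia.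
  have lab' : pos (f a') < pos (f b') by lia.
  rewrite /colour lab in cab; rewrite /colour lab' in cab'.
  by apply: (queue (f a) (f b) (f a') (f b')); rewrite ?cab ?cab'.
- move=> k l kl.
  have [k7 l7] : k < 7 /\ l < 7 by elim/gadget_edges_ind: k l / kl.
  exists (colour (V i k) (V i l)); rewrite /ed !f0 // !f1 // eqxx.
  rewrite -(typE _ _ k7 l7).2 eqxx (glued_vtx kl (VE i k _ _) (VE i l _ _)) //.
  by rewrite (glued_vtx kl (VE j k _ _) (VE j l _ _)).
- by move=> k l k7 l7; rewrite /= !f0 // !f1 // (typE _ _ k7 l7).1.
- by rewrite /= f0 // f1.
Qed.

(** * A planar drawing *)

Local Open Scope ring_scope.

Section Drawing.
Variable R : realType.
Implicit Types (x y s t : R) (c k l : nat).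

(** The three common neighbours are stacked above the edge xy, so their paths from x to y are
    nested. *)
Definition xcoord k : R := nth 0 [:: 0; 0; 1; 7; 4; 4; 4] k.
Definition ycoord k : R := nth 0 [:: 4; - 4; 0; 0; 1; 2; 3] k.

(* Every copy is drawn with straight segments in the strip [0 < x < 8],
   [-4 <= y <= 4], where the whole top and bottom sides stand for A and B.  The
   map [squeeze] places the strips next to each other and contracts the line
   [y = 4] to A and the line [y = -4] to B. *)
Definition squeeze c x y : R * R := ((4 - `|y|) * (x + 8 * c%:R), y).

(* An edge from A or B is a vertical segment in the strip. *)
Definition segx k l t : R :=
  (1 - t) * xcoord (if (k < 2)%N then l else k) + t * xcoord l.
Definition segy k l t : R := (1 - t) * ycoord k + t * ycoord l.

(** Off the contracted lines the factor of [squeeze] is invertible, and strips of width 8 are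
    disjoint. *)
Lemma squeeze_inj c c' x y x' y' : - 4 < y < 4 -> 0 < x < 8 -> 0 < x' < 8 ->
  squeeze c x y = squeeze c' x' y' -> [/\ c = c', x = x' & y = y'].
Proof.
move=> y4 x8 x8' [+ yy']; rewrite -yy'.
have y0 : 4 - `|y| != 0 by rewrite subr_eq0 gt_eqF // ltr_norml.
move/(mulfI y0) => xx'.
have sep (d d' : nat) (z z' : R) : 0 < z < 8 -> 0 < z' < 8 ->
    z + 8 * d%:R = z' + 8 * d'%:R -> (d' <= d)%N.
  move=> z8 z8' zz'; rewrite leqNgt; apply/negP.
  by move: zz'; rewrite -(ler_nat R) -natr1; lra.
have cc' : c = c'.
  by apply/eqP; rewrite eqn_leq (sep _ _ _ _ x8 x8' xx') (sep _ _ _ _ x8' x8).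
by split=> //; move: xx'; rewrite cc'; apply: addIr.
Qed.

Lemma segx_bounds k l t : (k, l) \in gadget_edges -> 0 <= t <= 1 ->
  0 < segx k l t < 8.
Proof.
move=> kl t01; rewrite /segx /xcoord.
by elim/gadget_edges_ind: k l / kl => /=; lra.
Qed.

Lemma segy_bounds k l t : (k, l) \in gadget_edges -> 0 < t < 1 ->
  - 4 < segy k l t < 4.
Proof.
move=> kl t01; rewrite /segy /ycoord.
by elim/gadget_edges_ind: k l / kl => /=; lra.
Qed.

(** Only xy is horizontal; elsewhere the height determines the parameter. The last hypothesis is
    conditional because [squeeze] forgets abscissas at heights 4 and -4. *)
Lemma seg_inj k l s t : (k, l) \in gadget_edges -> 0 <= s <= 1 -> 0 <= t <= 1 ->
  segy k l s = segy k l t ->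
  (- 4 < segy k l s < 4 -> segx k l s = segx k l t) -> s = t.
Proof.
move=> kl s01 t01; rewrite /segx /segy /xcoord /ycoord.
by elim/gadget_edges_ind: k l / kl => /=; try lra; move=> _ /(_ _); lra.
Qed.

Lemma seg_disjoint k l k' l' s t :
  (k, l) \in gadget_edges -> (k', l') \in gadget_edges ->
  0 < s < 1 -> 0 < t < 1 ->
  segx k l s = segx k' l' t -> segy k l s = segy k' l' t -> k = k' /\ l = l'.
Proof.
move=> kl kl' s01 t01; rewrite /segx /segy /xcoord /ycoord.
by elim/gadget_edges_ind: k l / kl; elim/gadget_edges_ind: k' l' / kl' => //= xx yy; exfalso; lra.
Qed.

Lemma seg_avoid k l j t : (k, l) \in gadget_edges -> (1 < j < 7)%N -> 0 < t < 1 ->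
  segx k l t = xcoord j -> segy k l t = ycoord j -> False.
Proof.
move=> kl j7 t01; rewrite /segx /segy /xcoord /ycoord.
by elim/gadget_edges_ind: k l / kl; move: j j7; do 7?[case=> //=]; move=> _ xx yy; exfalso; lra.
Qed.

Definition vertex_point (v : nat) : R * R :=
  squeeze (copy v) (xcoord (kind v)) (ycoord (kind v)).

(** The strip is that of [v], the end that is never A or B when [u < v]. *)
Definition edge_curve (u v : nat) (t : R) : R * R :=
  squeeze (copy v) (segx (kind u) (kind v) t) (segy (kind u) (kind v) t).

Lemma edge_curve_continuous u v : continuous (edge_curve u v).
Proof.
have seg_cont (a b : R) : continuous (fun t : R => (1 - t) * a + t * b).
  move=> t; apply: cvgD; apply: cvgM; try exact: cvg_cst; last exact: cvg_id.
  by apply: cvgB; [exact: cvg_cst|exact: cvg_id].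
move=> t; rewrite /edge_curve /squeeze.
apply: (@cvg_pair _ _ _ _
    (nbhs ((4 - `|segy (kind u) (kind v) t|) * (segx (kind u) (kind v) t + 8 * (copy v)%:R)))
    (nbhs (segy (kind u) (kind v) t))); last exact: seg_cont.
apply: cvgM.
  by apply: cvgB; [exact: cvg_cst|apply: cvg_norm; exact: seg_cont].
by apply: cvgD; [exact: seg_cont|exact: cvg_cst].
Qed.

Lemma coord_inner k : (1 < k < 7)%N ->
  (- 4 < ycoord k < 4) /\ (0 < xcoord k < 8).
Proof. by rewrite /ycoord /xcoord; do 7?[case: k => [|k] //=]; move=> _; split; lra. Qed.

Lemma ycoord_hub k : (k < 2)%N -> (- 4 < ycoord k < 4) = false.
Proof. by case: k => [|[|]] //= _; apply/negP; rewrite /ycoord /=; lra. Qed.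

Lemma coord_inj k l : (k < 7)%N -> (l < 7)%N ->
  ycoord k = ycoord l -> (- 4 < ycoord k < 4 -> xcoord k = xcoord l) -> k = l.
Proof.
rewrite /ycoord /xcoord.
do 7?[case: k => [|k] //=]; do 7?[case: l => [|l] //=]; move=> _ _ yy xx; exfalso; lra.
Qed.

Lemma vertex_point_inj : injective vertex_point.
Proof.
move=> u v uv; have yy : ycoord (kind u) = ycoord (kind v) by case: uv.
case: (ltnP (kind u) 2) => [ku|ku].
  have := ycoord_hub ku; rewrite yy => hv.
  have kv : (kind v < 2)%N.
    rewrite ltnNge; apply/negP => kv.
    have kv7 : (1 < kind v < 7)%N by rewrite kv kind_lt7.
    by have [] := coord_inner kv7; rewrite hv.
  apply: kind_copy; last by rewrite ltnNge -kind_ge2 -ltnNge ku.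
  by apply: (coord_inj (kind_lt7 _) (kind_lt7 _) yy); rewrite yy hv.
have ku7 : (1 < kind u < 7)%N by rewrite ku kind_lt7.
have [yu xu] := coord_inner ku7.
case: (ltnP (kind v) 2) => [kv|kv].
  by move: yu; rewrite yy (ycoord_hub kv).
have kv7 : (1 < kind v < 7)%N by rewrite kv kind_lt7.
have [yv xv] := coord_inner kv7.
have [cc xx _] := squeeze_inj yu xu xv uv.
apply: kind_copy; last by rewrite cc eqxx orbT.
exact: coord_inj (kind_lt7 _) (kind_lt7 _) yy (fun=> xx).
Qed.

End Drawing.

Lemma glued_planar N : planar (@glued N).
Proof.
pose RR := Rdefinitions.R : realType.
exists (fun v => @vertex_point RR v), (fun u v => @edge_curve RR u v).
split; first by move=> u v /vertex_point_inj /val_inj.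
split=> [u v /glued_edgeP[kl v2 cuv]|u v u' v' /glued_edgeP[kl v2 cuv] /glued_edgeP[kl' v2' cuv'] s t s01 t01].
  split.
    rewrite /edge_curve /vertex_point /segx /segy subr0 !mul1r !mul0r !addr0 /squeeze.
    (* At A or B the factor of [squeeze] vanishes, so every vertical segment starts at the same
       point. *)
    case: ifP => ku.
      suff -> : 4 - `|ycoord RR (kind u)| = 0 by rewrite !mul0r.
      by case: (kind u) ku => [|[|]] //= _; rewrite /ycoord /= ?normrN ger0_norm ?subrr //; lra.
    by move: cuv; rewrite ltnNge -kind_ge2 -ltnNge ku /= => /eqP ->.
  split.
    by rewrite /edge_curve /vertex_point /segx /segy subrr !mul1r !mul0r !add0r.
  split; first by apply: continuous_subspaceT; apply: edge_curve_continuous.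
  split=> [s t s01 t01 st|t w t01 tw].
    have yy : segy (R := RR) (kind u) (kind v) s = segy (kind u) (kind v) t by case: st.
    apply: (seg_inj kl s01 t01 yy) => y4.
    by have [] := squeeze_inj y4 (segx_bounds kl s01) (segx_bounds kl t01) st.
  have y4 := segy_bounds kl t01.
  have /(segx_bounds kl) x8 : 0 <= t <= 1 by lra.
  case: (ltnP (kind w) 2) => [kw|kw].
    by have := ycoord_hub RR kw; case: tw y4 => _ -> ->.
  have kw7 : (1 < kind w < 7)%N by rewrite kw kind_lt7.
  have [_ xw] := coord_inner RR kw7.
  have [_ xx yy] := squeeze_inj y4 x8 xw tw.
  exact: seg_avoid kl kw7 t01 xx yy.
move=> st.
have y4 := segy_bounds kl s01.
have /(segx_bounds kl) x8 : 0 <= s <= 1 by lra.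
have /(segx_bounds kl') x8' : 0 <= t <= 1 by lra.
have [cc xx yy] := squeeze_inj y4 x8 x8' st.
have [ku kv] := seg_disjoint kl kl' s01 t01 xx yy.
have vv : v = v' by apply/val_inj/kind_copy; rewrite // cc eqxx orbT.
(* If [u] is A or B, its kind determines it; otherwise it shares the copy of [v]. *)
split=> //; apply/val_inj/kind_copy => //; move: cuv cuv'; rewrite vv.
case: ltnP => //= u2 /eqP ->; rewrite ltnNge -kind_ge2 -ku kind_ge2 u2 /=.
by rewrite eq_sym.
Qed.

Local Close Scope ring_scope.

Theorem theorem1 :
  exists (n : nat) (e : rel 'I_n),
    simple_graph e /\ planar e /\ ~ has_mixed_1s1q_layout e.
Proof.
have [N no_layout] := glued_no_layout.
exists (5 * N).+2, (@glued N); split; first exact: glued_simple.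
by split; first exact: glued_planar.
Qed.
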